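(* Fix nested consistent sets $\Theta_1\subseteq\Theta_2\subseteq\cdots\subseteq\Theta_n\subseteq\mathcal{I}$ and let $\Delta=\{\boldsymbol\delta=(\delta_1,\dots,\delta_n)\in\mathbb{R}^n : 1\ge\delta_1\ge\delta_2\ge\cdots\ge\delta_n\ge 0\}$. Then the optimal DRCR $$\mathrm{DRCR}^*(\boldsymbol\delta)=\inf_A \mathrm{DRCR}_{\boldsymbol\Theta,\boldsymbol\delta}(A),\qquad \boldsymbol\delta\in\Delta,$$ where the infimum is over all algorithms $A$, is a concave function of $\boldsymbol\delta$ on $\Delta$ and is non-decreasing in each coordinate $\delta_i$ (that is, $\boldsymbol\delta,\boldsymbol\delta'\in\Delta$ with $\delta_i\le\delta_i'$ for all $i$ implies $\mathrm{DRCR}^*(\boldsymbol\delta)\le\mathrm{DRCR}^*(\boldsymbol\delta')$).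
   Context: $[n]=\{1,\dots,n\}$. $\mathcal{I}$ is the set of instances of an online minimization problem, with a fixed class of (possibly randomized) algorithms not depending on $\boldsymbol\delta$. For an algorithm $A$ and instance $I$, $\mathrm{ALG}(I)$ is the expected cost of $A$ on $I$ and $\mathrm{OPT}(I)>0$ is the offline optimal cost, so $\mathrm{ALG}(I)/\mathrm{OPT}(I)\ge 1$. Each consistent set $\Theta_i$ is nonempty; $\boldsymbol\Theta=(\Theta_i)_{i\in[n]}$. $\mathcal{D}_{\boldsymbol\Theta,\boldsymbol\delta}$ is the set of all probability distributions $d$ on $\mathcal{I}$ with $\Pr_{I\sim d}[I\in\Theta_i]\ge 1-\delta_i$ for all $i\in[n]$ (point masses are allowed; the $\Theta_i$ and the ratio function are taken to be measurable). The distributionally-robust competitive ratio is $$\mathrm{DRCR}_{\boldsymbol\Theta,\boldsymbol\delta}(A)=\sup_{d\in\mathcal{D}_{\boldsymbol\Theta,\boldsymbol\delta}}\mathbb{E}_{I\sim d}\left[\frac{\mathrm{ALG}(I)}{\mathrm{OPT}(I)}\right].$$ Values are in $[1,+\infty]$; concavity is understood in the extended-real sense. *)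

(* Defs.v *)
From HB Require Import structures.
From mathcomp Require Import all_boot all_order all_algebra.
From mathcomp Require Import all_classical all_reals all_analysis measurable_realfun.

Set Implicit Arguments.
Unset Strict Implicit.
Unset Printing Implicit Defensive.

Import Order.TTheory GRing.Theory Num.Theory.
Import numFieldNormedType.Exports.

Local Open Scope classical_set_scope.
Local Open Scope ring_scope.

(* A possibly randomized algorithm for problem instances of type [Inst], seen
   through its costs: it draws a random seed from its own probability space and
   then incurs a cost on the instance.  Deterministic algorithms are those whose
   cost ignores the seed.  Costs may be infinite, hence so may expectations. *)
Record algorithm (R : realType) (Inst : Type) := Algorithm {
  seed_display : measure_display;
  seed : measurableType seed_display;
  seed_law : probability seed R;
  cost : Inst -> seed -> \bar R;
  measurable_cost : forall I, measurable_fun setT (cost I)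
}.
Arguments seed_law {R Inst} _.
Arguments cost {R Inst} _ _ _.

Section drcr.
Context {R : realType} {d : measure_display} {Inst : measurableType d}.
Implicit Types (A : algorithm R Inst) (OPT : Inst -> R).

Definition ALG A (I : Inst) : \bar R :=
  (\int[seed_law A]_w cost A I w)%E.

Definition cost_ratio OPT A (I : Inst) : \bar R :=
  (ALG A I * ((OPT I)^-1)%:E)%E.

Context {n : nat}.
Implicit Types (Theta : 'I_n -> set Inst) (delta : 'rV[R]_n).

Definition consistent_distributions Theta delta : set (probability Inst R) :=
  [set P | forall i, ((1 - delta 0 i)%:E <= P (Theta i))%E].

Definition DRCR OPT Theta delta A : \bar R :=
  ereal_sup [set (\int[P]_I cost_ratio OPT A I)%E |
               P in consistent_distributions Theta delta].

(* The class of algorithms is a family indexed by a type, since [algorithm R Inst]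
   quantifies over seed spaces and is too large to be the carrier of a [set]. *)
Definition optimal_DRCR (Alg : Type) (algs : Alg -> algorithm R Inst)
    OPT Theta delta : \bar R :=
  ereal_inf [set DRCR OPT Theta delta (algs a) | a in [set: Alg]].

End drcr.

Definition Delta (R : realType) (n : nat) : set 'rV[R]_n :=
  [set delta | (forall i, 0 <= delta 0 i <= 1) /\
               (forall i j : 'I_n, (i <= j)%N -> delta 0 j <= delta 0 i)].

(* Jensen's inequality in the extended reals, where [0 * +oo = 0] by
   convention, so that the cases [t = 0] and [t = 1] are trivial. For functions
   that do not take both values [+oo] and [-oo] the left-hand side is never of
   the form [+oo - oo]. *)
Definition econcave_on (R : realType) (V : lmodType R) (D : set V)
    (f : V -> \bar R) :=
  convex_set (D : set (convex_lmodType V)) /\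
  forall (x y : V) (t : R), D x -> D y -> 0 <= t <= 1 ->
    (t%:E * f x + (1 - t)%:E * f y <= f (t *: x + (1 - t) *: y)%R)%E.

(* Main.v *)
(* If [P] and [Q] are consistent with [x] and [y], the mixture of [P] and [Q]
   with weights [t] and [1 - t] is consistent with [t x + (1 - t) y], and
   expectations are affine in the distribution.  So the DRCR of each single
   algorithm is concave, and an infimum of concave functions is concave. *)
Require Import Defs.
From HB Require Import structures.
From mathcomp Require Import all_boot all_order all_algebra.
From mathcomp Require Import all_classical all_reals all_analysis measurable_realfun.
From mathcomp Require Import ring lra.

Import Order.TTheory GRing.Theory Num.Theory.
Import numFieldNormedType.Exports.

Local Open Scope classical_set_scope.
Local Open Scope ring_scope.

Section mixture.
Context {R : realType} {d : measure_display} {T : measurableType d}.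
Variables (P Q : probability T R) (t : R) (t01 : 0 <= t <= 1).

Fact mixture_weight1 : 0 <= t. Proof. by case/andP: t01. Qed.
Fact mixture_weight2 : 0 <= 1 - t.
Proof. by rewrite subr_ge0; case/andP: t01. Qed.

(** Assembled from [measure_add] and [mscale], so that the measure structure is inherited and
    integrals against it split by additivity and scaling. *)
Definition mixture : set T -> \bar R :=
  measure_add (mscale (NngNum mixture_weight1) P)
              (mscale (NngNum mixture_weight2) Q).

HB.instance Definition _ := Measure.on mixture.

Lemma mixtureE A : (mixture A = t%:E * P A + (1 - t)%:E * Q A)%E.
Proof. by rewrite /mixture measure_addE. Qed.

Fact mixture_setT : (mixture setT = 1)%E.
Proof.
by rewrite mixtureE !probability_setT !mule1 -EFinD subrKC.
Qed.

HB.instance Definition _ :=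
  Measure_isProbability.Build _ _ _ mixture mixture_setT.

(** Nonnegativity stands in for integrability, so infinite expectations are covered too. *)
Lemma ge0_integral_mixture (f : T -> \bar R) :
  (forall x, 0 <= f x)%E -> measurable_fun setT f ->
  (\int[mixture]_x f x = t%:E * \int[P]_x f x + (1 - t)%:E * \int[Q]_x f x)%E.
Proof.
move=> f0 mf.
by rewrite ge0_integral_measure_add// !ge0_integral_mscale.
Qed.

End mixture.
Arguments mixture {R d T} P Q {t} t01.
Arguments ge0_integral_mixture {R d T} P Q {t} t01 {f}.

(** A finite [b] moves to the right-hand side, where the bound passes to the supremum; infinite [b]
    cannot be subtracted and is treated apart. *)
Lemma ereal_supD_le_r {R : realType} (S : set (\bar R)) (b c : \bar R) :
  (forall s, S s -> s + b <= c)%E -> (ereal_sup S + b <= c)%E.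
Proof.
case: b => [r| |] Sc.
- by rewrite -leeBrDr//; apply: ge_ereal_sup => s /Sc; rewrite leeBrDr.
(* For [b = +oo]: since [-oo + +oo = -oo], a supremum [-oo] is harmless. Otherwise some [s] in [S]
   differs from [-oo], so [s + b = +oo] and [c] must be [+oo]. *)
- have [->|/eqP supS] := eqVneq (ereal_sup S) -oo%E.
    by rewrite leNye.
  have [s Ss sNy] : exists2 s, S s & s != -oo%E.
    apply/not_exists2P => SNy; apply: supS; apply/ereal_sup_ninfty => s Ss /=.
    by have [//|/negP/negPn/eqP] := SNy s.
  by have := Sc s Ss; rewrite addey// leye_eq => /eqP ->; rewrite leey.
- by rewrite addeNy leNye.
Qed.

(** The two suprema are taken one at a time, the other summand being held fixed. *)
Lemma ereal_supD_le {R : realType} (S S' : set (\bar R)) (c : \bar R) :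
  (forall s s', S s -> S' s' -> s + s' <= c)%E ->
  (ereal_sup S + ereal_sup S' <= c)%E.
Proof.
move=> SS'c; apply: ereal_supD_le_r => s Ss; rewrite addeC.
by apply: ereal_supD_le_r => s' Ss'; rewrite addeC; exact: SS'c.
Qed.

Lemma convex_Delta (R : realType) (n : nat) (x y : 'rV[R]_n) (t : R) :
  Delta x -> Delta y -> 0 <= t <= 1 -> Delta (t *: x + (1 - t) *: y).
Proof.
move=> [x01 xle] [y01 yle] /andP[t0 t1]; split=> [i|i j ij]; rewrite !mxE.
  have := x01 i; have := y01 i; nra.
have := xle _ _ ij; have := yle _ _ ij; nra.
Qed.

Section drcr_theory.
Context {R : realType} {d : measure_display} {Inst : measurableType d}.
Context {n : nat}.
Implicit Types (A : algorithm R Inst) (OPT : Inst -> R).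
Implicit Types (Theta : 'I_n -> set Inst) (x y delta : 'rV[R]_n).

Lemma consistent_mixture Theta x y (P Q : probability Inst R) (t : R)
    (t01 : 0 <= t <= 1) :
  consistent_distributions Theta x P -> consistent_distributions Theta y Q ->
  consistent_distributions Theta (t *: x + (1 - t) *: y) (mixture P Q t01).
Proof.
move=> xP yQ i; rewrite /= mixtureE !mxE; have /andP[t0 t1] := t01.
(* The required probability is affine in the tolerance, so the two consistency bounds add up with
   weights [t] and [1 - t]. *)
have -> : 1 - (t * x 0 i + (1 - t) * y 0 i) =
          t * (1 - x 0 i) + (1 - t) * (1 - y 0 i) by ring.
by rewrite EFinD !EFinM leeD// lee_wpmul2l// lee_fin// subr_ge0.
Qed.

Lemma DRCR_concave OPT Theta A x y (t : R) :
  (forall I, 0 <= cost_ratio OPT A I)%E ->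
  measurable_fun setT (cost_ratio OPT A) -> 0 <= t <= 1 ->
  (t%:E * DRCR OPT Theta x A + (1 - t)%:E * DRCR OPT Theta y A <=
   DRCR OPT Theta (t *: x + (1 - t) *: y) A)%E.
Proof.
(* The endpoints [t = 0] and [t = 1] are split off, because only a positive factor is moved inside a
   supremum. *)
move=> r0 mr t01; have /andP[] := t01; rewrite le_eqVlt => /predU1P[<- _|t0].
  by rewrite subr0 mul0e mul1e add0e scale0r scale1r add0r.
rewrite le_eqVlt => /predU1P[->|t1].
  by rewrite subrr mul0e mul1e adde0 scale0r scale1r addr0.
rewrite /DRCR -!ereal_sup_pZl// ?subr_gt0//.
apply: ereal_supD_le => _ _ [_ [P xP <-] <-] [_ [Q yQ <-] <-].
rewrite -(ge0_integral_mixture P Q t01)//.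
apply: ereal_sup_ubound; exists (mixture P Q t01) => //.
exact: consistent_mixture.
Qed.

(** Larger tolerances lower the probability thresholds, so the supremum runs over a larger set of
    distributions. *)
Lemma DRCR_nondecreasing OPT Theta A x y :
  (forall i, x 0 i <= y 0 i) -> (DRCR OPT Theta x A <= DRCR OPT Theta y A)%E.
Proof.
move=> xy; apply: ereal_sup_le; apply: image_subset => P xP i.
by apply: le_trans (xP i); rewrite lee_fin lerB.
Qed.

End drcr_theory.

Theorem mainTheorem3 (R : realType) (d : measure_display)
    (Inst : measurableType d)
    (Alg : Type) (algs : Alg -> algorithm R Inst) (OPT : Inst -> R)
    (OPT_gt0 : forall I, 0 < OPT I)
    (ratio_ge1 : forall a I, (1 <= cost_ratio OPT (algs a) I)%E)
    (measurable_ratio : forall a, measurable_fun setT (cost_ratio OPT (algs a)))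
    (n : nat) (Theta : 'I_n -> set Inst)
    (measurable_Theta : forall i, measurable (Theta i))
    (Theta_neq0 : forall i, Theta i !=set0)
    (Theta_nested : forall i j : 'I_n, (i <= j)%N -> Theta i `<=` Theta j) :
  econcave_on (@Delta R n) (optimal_DRCR algs OPT Theta) /\
  (forall delta delta' : 'rV[R]_n, Delta delta -> Delta delta' ->
     (forall i, delta 0 i <= delta' 0 i) ->
     (optimal_DRCR algs OPT Theta delta <= optimal_DRCR algs OPT Theta delta')%E).
Proof.
split=> [|x y _ _ xy]; last first.
  apply: le_ereal_inf_tmp => _ [a _ <-].
  apply: le_trans (DRCR_nondecreasing _ _ _ _ _ xy).
  by apply: ereal_inf_lbound; exists a.
split=> [x y t /[!inE] Dx Dy|x y t _ _ t01].
  by apply: convex_Delta => //; apply/andP; split.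
(* It suffices to bound the left-hand side by the DRCR of an arbitrary algorithm [a] at the combined
   point. *)
apply: le_ereal_inf_tmp => _ [a _ <-].
have r0 I : (0 <= cost_ratio OPT (algs a) I)%E by exact: le_trans (ratio_ge1 a I).
apply: le_trans (DRCR_concave _ _ _ x y _ r0 (measurable_ratio a) t01).
have /andP[t0 t1] := t01.
(* The same [a] bounds the infima at [x] and at [y]; the weights are nonnegative, so both bounds
   survive scaling. *)
by apply: leeD; apply: lee_wpmul2l; rewrite ?lee_fin ?subr_ge0//;
  apply: ereal_inf_lbound; exists a.
Qed.
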